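(* Let $(G_n)_{n\ge 1}$ be a sequence of (possibly random, almost surely finite) graphs, let $o_n$ be a uniformly chosen vertex of $G_n$, and assume that $(d_{o_n})_{n\ge 1}$ is uniformly integrable. Let $(G,o)$ be a random connected locally finite rooted graph with law $\mu$ such that $\mu(d_o\ge 1)>0$, and assume that $G_n$ converges locally in probability to $(G,o)$. Then $$\tau(G_n)\ \xrightarrow{\ \mathbb{P}\ }\ \frac{\mathbb{E}_\mu[d_o\,\mathcal{H}_\mu(d_o,d_V)]}{\mathbb{E}_\mu[d_o]}-1\qquad (n\to\infty),$$ where $V$ is a neighbour of $o$ in $G$ chosen uniformly at random, $\mathcal{H}_\mu(k,\ell)=H_\mu(k,\ell)+H_\mu(k-1,\ell)+H_\mu(k,\ell-1)+H_\mu(k-1,\ell-1)$ and $$H_\mu(k,\ell)=\frac{\mathbb{E}_\mu[d_o\mathbf{1}_{\{d_o\le k\}}\mathbf{1}_{\{d_V\le \ell\}}]}{\mathbb{E}_\mu[d_o]}.$$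
   Context: Graphs are simple and undirected; $d_v$ denotes the degree of vertex $v$. For a graph $G$, $\vec{E}(G)$ is the set of ordered pairs $(u,v)$ with $\{u,v\}\in E(G)$ (each undirected edge gives two directed edges), and $\sum_{u\to v}$ denotes summation over $(u,v)\in\vec{E}(G)$. Local convergence in probability: for a locally finite rooted graph $(G,o)$ and integer $r\ge 0$, $B_r^{(G)}(o)$ is the subgraph of $G$ induced by the vertices at graph distance at most $r$ from $o$, rooted at $o$; $\simeq$ denotes isomorphism of rooted graphs (a graph isomorphism mapping root to root). The sequence $G_n$ converges locally in probability to the random connected rooted graph $(G,o)$ with law $\mu$ if for every rooted graph $H_\star$ and every integer $r\ge 0$, $\frac{1}{|V(G_n)|}\sum_{v\in V(G_n)}\mathbf{1}_{\{B_r^{(G_n)}(v)\simeq H_\star\}}\to\mu(B_r^{(G)}(o)\simeq H_\star)$ in probability as $n\to\infty$. $\mathbb{E}_\mu$ is expectation over $(G,o)\sim\mu$ and over the uniform choice of the neighbour $V$; when $d_o=0$ the integrand containing the factor $d_o$ is $0$. Uniform integrability of $(d_{o_n})$ is with respect to the joint randomness of $G_n$ and $o_n$. Kendall's tau of a finite graph $G$: for integers $k,\ell$ let $H_G(k,\ell)=\frac{1}{|\vec{E}(G)|}\sum_{u\to v}\mathbf{1}_{\{d_u\le k,\,d_v\le \ell\}}$ and $\mathcal{H}_G(k,\ell)=H_G(k,\ell)+H_G(k-1,\ell)+H_G(k,\ell-1)+H_G(k-1,\ell-1)$. Then $$\tau(G)=\frac{1}{|\vec{E}(G)|}\sum_{u\to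 v}\mathcal{H}_G(d_u,d_v)-1,$$ with an arbitrary value assigned if $G$ has no edges. *)

(* Defs.v *)
From HB Require Import structures.
From mathcomp Require Import all_boot all_order all_algebra finmap.
From mathcomp Require Import all_classical all_reals all_analysis.

Set Implicit Arguments.
Unset Strict Implicit.
Unset Printing Implicit Defensive.

Import Order.TTheory GRing.Theory Num.Theory numFieldNormedType.Exports.

Local Open Scope classical_set_scope.
Local Open Scope ring_scope.

(* Simple undirected graphs on an arbitrary, possibly infinite, vertex type. *)
Record graph := Graph {
  vertex :> choiceType;
  adj : rel vertex;
  adj_sym : symmetric adj;
  adj_irr : irreflexive adj }.

Record rooted_graph := Rooted { rgraph :> graph; root : rgraph }.

Definition finite_graph (G : graph) : Prop := finite_set [set: G].

Definition nbrs (G : graph) (v : G) : set G := [set w | adj v w].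

(* [fset_set A] is empty when [A] is infinite: [deg v] is 0 for a vertex [v]
   with infinitely many neighbours and [order G] is 0 for an infinite [G]. *)
Definition deg (G : graph) (v : G) : nat := #|` fset_set (nbrs v)|%fset.

Definition order (G : graph) : nat := #|` fset_set [set: G]|%fset.

Definition darts (G : graph) : set (G * G) := [set e | adj e.1 e.2].

Definition locally_finite (G : graph) : Prop :=
  forall v : G, finite_set (nbrs v).

Definition connected_graph (G : graph) : Prop :=
  forall u v : G, exists2 p : seq G, path (@adj G) u p & last u p = v.

(* The graph distance from [u] to [v] is at most [r]. *)
Definition dist_le (G : graph) (r : nat) (u v : G) : Prop :=
  exists p : seq G, [/\ path (@adj G) u p, last u p = v & (size p <= r)%N].

Lemma dist_le_refl (G : graph) (r : nat) (u : G) : dist_le r u u.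
Proof. by exists [::]. Qed.

Section Induced.
Variables (G : graph) (A : set G).

Definition induced_adj : rel (set_type A) := fun x y => adj (val x) (val y).

Lemma induced_adj_sym : symmetric induced_adj.
Proof. by move=> x y; exact: adj_sym. Qed.

Lemma induced_adj_irr : irreflexive induced_adj.
Proof. by move=> x; exact: adj_irr. Qed.

Definition induced : graph := Graph induced_adj_sym induced_adj_irr.

End Induced.

Definition ball_verts (G : graph) (r : nat) (o : G) : set G :=
  [set v | dist_le r o v].

Definition ball_graph (r : nat) (H : rooted_graph) : rooted_graph :=
  @Rooted (induced (ball_verts r (root H)))
    (SigSub (mem_set (dist_le_refl r (root H)))).

Definition giso (G H : graph) : Prop :=
  exists2 f : G -> H, bijective f & forall x y : G, adj (f x) (f y) = adj x y.

Definition riso (G H : rooted_graph) : Prop :=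
  exists f : G -> H,
    [/\ bijective f, forall x y : G, adj (f x) (f y) = adj x y
      & f (root G) = root H].

(* Expectation over a uniform vertex of [G]; it is 0 if [G] is infinite. *)
Definition vertex_mean (R : realType) (G : graph) (f : G -> R) : R :=
  (\sum_(v \in [set: G]) f v) / (order G)%:R.

(* Expectation over a uniform neighbour of [o]; it is 0 if [deg o = 0]. *)
Definition nbr_mean (R : realType) (G : graph) (o : G) (f : G -> R) : R :=
  (\sum_(v \in nbrs o) f v) / (deg o)%:R.

Section Kendall.
Variables (R : realType) (G : graph).

Definition ndarts : nat := #|` fset_set (darts (G := G))|%fset.

Definition dart_mean (f : G -> G -> R) : R :=
  ndarts%:R^-1 * \sum_(e \in darts (G := G)) f e.1 e.2.

Definition H_G (k l : int) : R :=
  dart_mean (fun u v => (((deg u)%:Z <= k) && ((deg v)%:Z <= l))%R%:R).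

Definition calH_G (k l : int) : R :=
  H_G k l + H_G (k - 1) l + H_G k (l - 1) + H_G (k - 1) (l - 1).

(* [c] is the arbitrary value of tau for a graph without edges; it is also
   used for infinite graphs, where tau is not defined. *)
Definition kendall_tau (c : R) : R :=
  if `[< finite_graph G /\ darts (G := G) !=set0 >] then
    dart_mean (fun u v => calH_G (deg u)%:Z (deg v)%:Z) - 1
  else c.

End Kendall.

(* Random graphs and random rooted graphs are maps from a probability space.
   For almost surely finite graphs, the sigma-algebra on isomorphism classes
   is the discrete one; for locally finite rooted graphs it is the Borel
   sigma-algebra of the local topology, generated by the balls around the
   root. *)
Definition random_finite_graph d (T : measurableType d) (R : realType)
    (P : probability T R) (G : T -> graph) : Prop :=
  (forall F : graph, finite_graph F -> measurable [set w | giso (G w) F]) /\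
  {ae P, forall w, finite_graph (G w) /\ [set: G w] !=set0}.

Definition random_rooted_graph d (T : measurableType d)
    (G : T -> rooted_graph) : Prop :=
  (forall (r : nat) (H : rooted_graph),
    measurable [set w | riso (ball_graph r (G w)) H]) /\
  (forall w, connected_graph (G w) /\ locally_finite (G w)).

(* Convergence in probability to a constant; the variables may live on
   different probability spaces. *)
Definition cvg_in_probability (R : realType) (d : nat -> measure_display)
    (T : forall n, measurableType (d n)) (P : forall n, probability (T n) R)
    (X : forall n, T n -> R) (c : R) : Prop :=
  forall eps : R, 0 < eps ->
    P n [set w | eps < `|X n w - c|] @[n --> \oo] --> 0%E.

(* E[f(G, o)] where, given [G], the vertex [o] is uniform. *)
Definition uniform_vertex_expectation d (T : measurableType d) (R : realType)
    (P : probability T R) (G : T -> graph) (f : forall H : graph, H -> R)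
    : \bar R :=
  'E_P[fun w => vertex_mean (f (G w))]%E.

Definition tail_deg (R : realType) (K : R) (H : graph) (v : H) : R :=
  (deg v)%:R * (K < (deg v)%:R)%R%:R.

(* Uniform integrability of the degree of a uniform vertex of [G n]:
   sup_n E[d_{o_n} 1{d_{o_n} > K}] tends to 0 as K tends to infinity. *)
Definition uniformly_integrable_degree (R : realType)
    (d : nat -> measure_display) (T : forall n, measurableType (d n))
    (P : forall n, probability (T n) R) (G : forall n, T n -> graph) : Prop :=
  forall eps : R, 0 < eps -> exists K : R, forall n : nat,
    (uniform_vertex_expectation (P n) (G n) (tail_deg K) <= eps%:E)%E.

Definition cvg_locally_in_probability (R : realType)
    (d : nat -> measure_display) (T : forall n, measurableType (d n))
    (P : forall n, probability (T n) R) (G : forall n, T n -> graph)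
    d' (T' : measurableType d') (mu : probability T' R)
    (Go : T' -> rooted_graph) : Prop :=
  forall (H : rooted_graph) (r : nat),
    cvg_in_probability P
      (fun n w => vertex_mean
        (fun v : G n w => (`[< riso (ball_graph r (Rooted v)) H >])%:R))
      (fine (mu [set w | riso (ball_graph r (Go w)) H])).

Section Limit.
Context d (T : measurableType d) (R : realType).
Variables (mu : probability T R) (Go : T -> rooted_graph).

Definition root_deg (w : T) : nat := deg (root (Go w)).

Definition E_root_deg : R := fine (expectation mu (fun w => (root_deg w)%:R)).

(* E_mu[d_o f(d_o, d_V)], with [V] a uniform neighbour of the root. *)
Definition E_root_nbr (f : int -> int -> R) : R :=
  fine (expectation mu (fun w => (root_deg w)%:R *
    nbr_mean (root (Go w)) (fun v => f (root_deg w)%:Z (deg v)%:Z))).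

Definition H_mu (k l : int) : R :=
  E_root_nbr (fun a b => (a <= k)%R%:R * (b <= l)%R%:R) / E_root_deg.

Definition calH_mu (k l : int) : R :=
  H_mu k l + H_mu (k - 1) l + H_mu k (l - 1) + H_mu (k - 1) (l - 1).

End Limit.

(* Main.v *)
(** Every quantity in the statement is a vertex average of a sum
    [nbr_sum phi v] = sum over the neighbours w of v of phi (deg v) (deg w),
    which only depends on the ball of radius 2 around v; for instance H_G(k,l)
    is a ratio of two such averages. There are countably many isomorphism types
    of finite rooted graphs, so local convergence is convergence of a sequence
    of laws on nat, and Fatou's lemma together with uniform integrability of
    the degree gives convergence of these averages for bounded phi.

    Convergence in probability is reduced to deterministic sequences: were tau
    at distance more than eps from the limit with probability more than eta for
    infinitely many n, a union bound would provide sample points on which tau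
    is eps-far from the limit although all ball frequencies converge and the
    degree is uniformly integrable along the sampled graphs. For such a
    sequence, calH_G converges pointwise to calH_mu and is bounded by 4; the
    darts with an endpoint of large degree are negligible by uniform
    integrability and the symmetry u <-> v of the set of darts. *)
Require Import Defs.
From HB Require Import structures.
From mathcomp Require Import all_boot all_order all_algebra finmap.
From mathcomp Require Import all_classical all_reals all_analysis.
From mathcomp Require Import measurable_realfun lra.
Set Implicit Arguments.
Unset Strict Implicit.
Unset Printing Implicit Defensive.

Import Order.TTheory GRing.Theory Num.Theory numFieldNormedType.Exports.
Local Open Scope classical_set_scope.
Local Open Scope ring_scope.
(* [all_algebra] and [all_order] shadow these two names of [Defs]. *)
Local Notation root := Defs.root.
Local Notation order := Defs.order.

(** * Graph isomorphisms and local functionals *)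

(** By injectivity an infinite [A] has an infinite image, and then both cardinals are the default
    value 0. *)
Lemma card_fset_set_image (T U : choiceType) (f : T -> U) (A : set T) :
  injective f -> #|` fset_set (f @` A)|%fset = #|` fset_set A|%fset.
Proof.
move=> fI; have [fA|nfA] := pselect (finite_set A).
  by rewrite fset_set_image// card_imfset.
have nfA' : ~ finite_set (f @` A).
  move=> h; apply: nfA; apply: (@sub_finite_set _ _ (f @^-1` (f @` A))).
    by move=> x Ax; exists x.
  by apply: finite_preimage => // x y _ _ /fI.
by rewrite /fset_set; case: pselect => //; case: pselect.
Qed.

Section Embedding.
Variables (G H : graph) (f : G -> H).
Hypothesis f_inj : injective f.

Lemma deg_image (v : G) : f @` nbrs v = nbrs (f v) -> deg (f v) = deg v.
Proof. by rewrite /deg => <-; rewrite card_fset_set_image. Qed.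

End Embedding.

Section NbrSum.
Variable R : realType.

(** On a locally finite graph this is $d_v$ times the mean of $\varphi(d_v,d_V)$ over a uniform
    neighbour $V$; summed over all vertices of a finite graph it gives a sum over darts. *)
Definition nbr_sum (phi : nat -> nat -> R) (G : graph) (v : G) : R :=
  \sum_(w \in nbrs v) phi (deg v) (deg w).

(** Only the neighbourhoods of [v] and of its neighbours have to be preserved, so this serves both
    for isomorphisms and for the inclusion of a ball. *)
Lemma nbr_sum_image (phi : nat -> nat -> R) (G H : graph) (f : G -> H) (v : G) :
  injective f -> f @` nbrs v = nbrs (f v) ->
  (forall w, adj v w -> f @` nbrs w = nbrs (f w)) ->
  nbr_sum phi (f v) = nbr_sum phi v.
Proof.
move=> fI fv fw; rewrite /nbr_sum -fv fsbig_image; last by move=> x y _ _ /fI.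
apply: eq_fsbigr => w; rewrite inE => /fw/(deg_image fI) ->.
by rewrite (deg_image fI fv).
Qed.

(** Radius 2 contains the neighbours of the root together with all of their neighbours, so all
    degrees that enter the sum are the same in the ball. *)
Lemma nbr_sum_ball (phi : nat -> nat -> R) (G : rooted_graph) :
  nbr_sum phi (root (ball_graph 2 G)) = nbr_sum phi (root G).
Proof.
symmetry; have := @nbr_sum_image phi (ball_graph 2 G) G val (root (ball_graph 2 G)).
apply.
- exact: val_inj.
- apply/seteqP; split=> [_ [x + <-]//|x /= ox].
  have xb : x \in ball_verts 2 (root G).
    by rewrite inE; exists [:: x]; split => //=; rewrite ox.
  by exists (SigSub xb).
- move=> w; rewrite [adj _ _]/(adj (root G) (val w)) => ow.
  apply/seteqP; split=> [_ [x + <-]//|x /= wx].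
  have xb : x \in ball_verts 2 (root G).
    by rewrite inE; exists [:: val w; x]; split => //=; apply/and3P; split.
  by exists (SigSub xb).
Qed.

End NbrSum.

Section Isomorphism.

Lemma giso_nbrs (G H : graph) (f : G -> H) (v : G) : bijective f ->
  (forall x y, adj (f x) (f y) = adj x y) -> f @` nbrs v = nbrs (f v).
Proof.
move=> [g fK gK] fadj; apply/seteqP; split => [_ [x vx <-]|y /= vy].
  by rewrite /nbrs/= fadj.
by exists (g y); rewrite ?gK// /nbrs/= -fadj gK.
Qed.

Lemma giso_sym (G H : graph) : giso G H -> giso H G.
Proof.
move=> [f [g fK gK] fadj]; exists g; first by exists f.
by move=> x y; rewrite -fadj !gK.
Qed.

Lemma riso_sym (G H : rooted_graph) : riso G H -> riso H G.
Proof.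
move=> [f [[g fK gK] fadj fr]]; exists g; split; first by exists f.
  by move=> x y; rewrite -fadj !gK.
by rewrite -fr fK.
Qed.

Lemma riso_trans (G H K : rooted_graph) : riso G H -> riso H K -> riso G K.
Proof.
move=> [f [fb fadj fr]] [g [gb gadj gr]]; exists (g \o f); split => /=.
- exact: bij_comp.
- by move=> x y; rewrite gadj.
- by rewrite fr.
Qed.

Lemma dist_le_iso (G H : graph) (f : G -> H) r (u v : G) :
  (forall x y, adj (f x) (f y) = adj x y) ->
  dist_le r u v -> dist_le r (f u) (f v).
Proof.
move=> fadj [p [pp lp sp]]; exists (map f p); split.
- by rewrite path_map; apply: sub_path pp => x y /=; rewrite fadj.
- by rewrite last_map lp.
- by rewrite size_map.
Qed.

Lemma riso_ball (G H : rooted_graph) r : riso G H ->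
  riso (ball_graph r G) (ball_graph r H).
Proof.
move=> [f [[g fK gK] fadj fr]].
have gadj x y : adj (g x) (g y) = adj x y by rewrite -fadj !gK.
have gr : g (root H) = root G by rewrite -fr fK.
have fb x : x \in ball_verts r (root G) -> f x \in ball_verts r (root H).
  by rewrite !inE -fr; exact: dist_le_iso.
have gb x : x \in ball_verts r (root H) -> g x \in ball_verts r (root G).
  by rewrite !inE -gr; exact: dist_le_iso.
exists (fun x => SigSub (fb _ (valP x))); split.
- by exists (fun x => SigSub (gb _ (valP x))) => x; apply/val_inj; rewrite /= ?fK ?gK.
- by move=> x y; rewrite [LHS]fadj.
- by apply/val_inj; rewrite /= fr.
Qed.

Lemma nbr_sum_riso (R : realType) (phi : nat -> nat -> R) (G H : rooted_graph) :
  riso G H -> nbr_sum phi (root G) = nbr_sum phi (root H).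
Proof.
move=> [f [fb fadj fr]]; rewrite -fr; symmetry; apply: nbr_sum_image.
- exact: bij_inj.
- exact: giso_nbrs.
- by move=> w _; exact: giso_nbrs.
Qed.

Lemma order_giso (G H : graph) : giso G H -> order G = order H.
Proof.
move=> [f fb _]; rewrite /order -(card_fset_set_image _ (bij_inj fb)).
congr (#|` fset_set _|%fset); apply/seteqP; split => // y _.
by case: fb => g fK gK; exists (g y).
Qed.

Lemma finite_giso (G H : graph) : giso G H -> finite_graph G -> finite_graph H.
Proof.
move=> [f [g fK gK] _] /(finite_image f); apply: sub_finite_set => y _.
by exists (g y).
Qed.

Lemma vertex_mean_giso (R : realType) (G H : graph) (f : G -> H)
    (F : G -> R) (F' : H -> R) :
  bijective f -> (forall x y, adj (f x) (f y) = adj x y) ->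
  (forall v, F' (f v) = F v) -> vertex_mean F = vertex_mean F'.
Proof.
move=> fb fadj FF'; rewrite /vertex_mean (@order_giso G H); last by exists f.
by rewrite (reindex_fsbigT f)//; congr (_ / _); apply: eq_fsbigr => v _.
Qed.

Lemma riso_of_iso (G H : graph) (f : G -> H) v : bijective f ->
  (forall x y, adj (f x) (f y) = adj x y) ->
  riso (Rooted v) (Rooted (f v)).
Proof. by move=> fb fadj; exists f. Qed.

Lemma vertex_mean_ball_giso (R : realType) (G H : graph) (K : rooted_graph) r :
  giso G H ->
  vertex_mean (fun v : G => (`[< riso (ball_graph r (Rooted v)) K >])%:R) =
  vertex_mean (fun v : H => (`[< riso (ball_graph r (Rooted v)) K >])%:R) :> R.
Proof.
move=> [f fb fadj]; apply: (vertex_mean_giso fb fadj) => v; congr (_%:R).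
have e := riso_ball r (riso_of_iso v fb fadj).
congr nat_of_bool; apply/asbool_equiv_eq; split; apply: riso_trans => //.
exact: riso_sym.
Qed.

Lemma vertex_mean_tail_giso (R : realType) (G H : graph) (K : R) :
  giso G H -> vertex_mean (@tail_deg R K G) = vertex_mean (@tail_deg R K H).
Proof.
move=> [f fb fadj]; apply: (vertex_mean_giso fb fadj) => v.
by rewrite /tail_deg (deg_image (bij_inj fb))//; exact: giso_nbrs.
Qed.

Lemma darts_image (G H : graph) (f : G -> H) : bijective f ->
  (forall x y, adj (f x) (f y) = adj x y) ->
  (fun e => (f e.1, f e.2)) @` darts (G := G) = darts (G := H).
Proof.
move=> [g fK gK] fadj; apply/seteqP; split => [_ [[x y] /= xy <-]|[x y] /= xy].
  by rewrite /darts/= fadj.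
by exists (g x, g y); rewrite /darts/= ?gK// -fadj !gK.
Qed.

Lemma dart_mean_giso (R : realType) (G H : graph) (f : G -> H)
    (F : G -> G -> R) (F' : H -> H -> R) :
  bijective f -> (forall x y, adj (f x) (f y) = adj x y) ->
  (forall u v, F' (f u) (f v) = F u v) -> dart_mean F = dart_mean F'.
Proof.
move=> fb fadj FF'; have fI := bij_inj fb.
have f2I : injective (fun e : G * G => (f e.1, f e.2)).
  by move=> [a b] [a' b'] /= [/fI -> /fI ->].
rewrite /dart_mean /ndarts -(darts_image fb fadj) card_fset_set_image//.
rewrite fsbig_image; last by move=> x y _ _ /f2I.
by congr (_ * _); apply: eq_fsbigr => e _ /=.
Qed.

Lemma kendall_tau_giso (R : realType) (G H : graph) (c : R) :
  giso G H -> kendall_tau G c = kendall_tau H c.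
Proof.
move=> GH; case: (GH) => f fb fadj; rewrite /kendall_tau.
have fdeg v : deg (f v) = deg v.
  by apply: deg_image; [exact: bij_inj|exact: giso_nbrs].
have fH k l : H_G R G k l = H_G R H k l.
  by apply: (dart_mean_giso fb fadj) => u v; rewrite !fdeg.
rewrite (_ : `[< _ >] = `[< finite_graph H /\ darts (G := H) !=set0 >]); last first.
  apply/asbool_equiv_eq; split=> -[fin [e ed]]; split.
  - exact: (finite_giso GH).
  - by rewrite -(darts_image fb fadj); eexists; exists e.
  - exact: (finite_giso (giso_sym GH)).
  - by move: ed; rewrite -(darts_image fb fadj) => -[e' e'd _]; exists e'.
case: asboolP => // _; congr (_ - 1); apply: (dart_mean_giso fb fadj) => u v.
by rewrite /calH_G !fdeg !fH.
Qed.

End Isomorphism.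

(** * Isomorphism types of finite graphs *)

Section Codes.

Definition graph_code := {n : nat & {ffun 'I_n * 'I_n -> bool}}.

(* Symmetrised, with the diagonal removed, so that every boolean function codes a
   simple graph. *)
Definition code_adj (c : graph_code) : rel 'I_(tag c) := fun x y =>
  (x != y) && (tagged c (x, y) || tagged c (y, x)).

Lemma code_adj_sym c : symmetric (@code_adj c).
Proof. by move=> x y; rewrite /code_adj eq_sym orbC. Qed.

Lemma code_adj_irr c : irreflexive (@code_adj c).
Proof. by move=> x; rewrite /code_adj eqxx. Qed.

Definition code_graph c : graph := Graph (@code_adj_sym c) (@code_adj_irr c).

(** Numbering the vertices by their position in an enumeration turns adjacency into a boolean
    function; [code_adj] leaves it unchanged because it is already symmetric and irreflexive. *)
Lemma finite_graph_code (G : graph) : finite_graph G ->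
  exists c, giso G (code_graph c).
Proof.
move=> fG; pose s : seq G := fset_set [set: G].
have sP x : x \in s by rewrite in_fset_set// inE.
have us : uniq s by exact: fset_uniq.
pose g (i : 'I_(size s)) : G := tnth (in_tuple s) i.
have fP x : (index x s < size s)%N by rewrite index_mem.
pose f x : 'I_(size s) := Ordinal (fP x).
have fK : cancel f g by move=> x; rewrite /g (tnth_nth x)/= nth_index.
have gK : cancel g f.
  move=> i; apply/val_inj => /=.
  by rewrite /g (tnth_nth (g i))/= index_uniq.
pose e : {ffun 'I_(size s) * 'I_(size s) -> bool} := [ffun p => adj (g p.1) (g p.2)].
exists (existT _ (size s) e); exists f; first by exists g.
move=> x y; rewrite [LHS]/(code_adj _ _) /code_adj /= !ffunE /= !fK.
rewrite [adj y x]adj_sym orbb (can_eq fK).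
by case: (eqVneq x y) => [->|//]; rewrite adj_irr.
Qed.

Definition rooted_code := {c : graph_code & 'I_(tag c)}.

Definition code_rooted (a : rooted_code) : rooted_graph :=
  @Rooted (code_graph (tag a)) (tagged a).

Definition default_code : rooted_code :=
  @existT graph_code (fun c => 'I_(tag c))
    (existT (fun n => {ffun 'I_n * 'I_n -> bool}) 1%N [ffun=> false]) ord0.

(** An enumeration with repetitions of the finite rooted graphs up to isomorphism: numbers that code
    nothing yield the one-vertex graph, and isomorphic graphs can have different codes. *)
Definition rooted_type (i : nat) : rooted_graph :=
  code_rooted (odflt default_code (choice.unpickle i)).

Lemma finite_rooted_type (G : rooted_graph) : finite_graph G ->
  exists i, riso G (rooted_type i).
Proof.
move=> /finite_graph_code[c [f fb fadj]].
exists (choice.pickle (@existT graph_code (fun c => 'I_(tag c)) c (f (root G)))).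
by rewrite /rooted_type choice.pickleK/=; exists f.
Qed.

End Codes.

(** * Balls in locally finite graphs *)

Section FiniteBalls.

Lemma ball_verts_finite (G : graph) r (o : G) : locally_finite G ->
  finite_set (ball_verts r o).
Proof.
move=> fG; elim: r => [|r IH].
  apply: (@sub_finite_set _ _ [set o]) => // v [p [_ <- ]].
  by rewrite leqn0 size_eq0 => /eqP ->.
apply: (@sub_finite_set _ _ (ball_verts r o `|` \bigcup_(u in ball_verts r o) nbrs u)).
  (* The path is cut at its last edge: its endpoint is a neighbour of a vertex in the ball of radius
     [r]. *)
  move=> v [p []]; case/lastP: p => [_ <- _|p x].
    by left; exists [::].
  rewrite rcons_path last_rcons size_rcons => /andP[pp px] <-{v} sp; right.
  by exists (last o p) => //; exists p.
by rewrite finite_setU; split=> //; apply: bigcup_finite => // u _; exact: fG.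
Qed.

Lemma ball_graph_finite r (G : rooted_graph) : locally_finite G ->
  finite_graph (ball_graph r G).
Proof.
move=> /(@ball_verts_finite _ r (root G)) fB.
have : finite_set (val @^-1` ball_verts r (root G) : set (ball_graph r G)).
  by apply: finite_preimage => // x y _ _ /val_inj.
by apply: sub_finite_set => x _ /=; have := valP x; rewrite inE.
Qed.

Lemma ball_rooted_type r (G : rooted_graph) : locally_finite G ->
  exists i, riso (ball_graph r G) (rooted_type i).
Proof. by move=> /(@ball_graph_finite r)/finite_rooted_type. Qed.

Lemma finite_graph_locally_finite (G : graph) : finite_graph G -> locally_finite G.
Proof. by move=> fG v; apply: sub_finite_set fG. Qed.

End FiniteBalls.

(** * Measurability of isomorphism-invariant properties *)

Section Measurability.
Context d (T : measurableType d) (R : realType) (P : probability T R).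
Variable G : T -> graph.
Hypothesis hG : random_finite_graph P G.

(** The event is the union of countably many isomorphism classes of finite graphs and of either all
    or none of the sample points with an infinite graph, as [Q] does not distinguish infinite
    graphs. *)
Lemma measurable_graph_property (Q : graph -> Prop) :
  (forall F H, giso F H -> Q F -> Q H) ->
  (forall F H, ~ finite_graph F -> ~ finite_graph H -> Q F -> Q H) ->
  measurable [set w | Q (G w)].
Proof.
move=> Qiso Qinf; have [Gm _] := hG.
have codefin c : finite_graph (code_graph c) by exact: finite_finset.
have mF : measurable [set w | finite_graph (G w)].
  rewrite (_ : mkset _ = \bigcup_c [set w | giso (G w) (code_graph c)]).
    by apply: countable_bigcupT_measurable => [|c]; [exact: countableP|exact: Gm].
  apply/seteqP; split=> [w /= /finite_graph_code[c wc]|w [c _ /= wc]].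
    by exists c.
  exact: finite_giso (giso_sym wc) _.
rewrite (_ : mkset _ =
    (\bigcup_c [set w | giso (G w) (code_graph c) /\ Q (code_graph c)]) `|`
    [set w | ~ finite_graph (G w) /\ exists2 F, ~ finite_graph F & Q F]).
  apply: measurableU.
    apply: countable_bigcupT_measurable => [|c]; first exact: countableP.
    have [q|nq] := pselect (Q (code_graph c)).
      rewrite (_ : mkset _ = [set w | giso (G w) (code_graph c)]); first exact: Gm.
      by apply/seteqP; split=> w //= -[].
    rewrite (_ : mkset _ = set0)//.
    by apply/seteqP; split=> w //= -[].
  have [q|nq] := pselect (exists2 F, ~ finite_graph F & Q F).
    rewrite (_ : mkset _ = ~` [set w | finite_graph (G w)]); first exact: measurableC.
    by apply/seteqP; split=> w //= -[].
  rewrite (_ : mkset _ = set0)//.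
  by apply/seteqP; split=> w //= -[].
apply/seteqP; split=> [w /= Qw|w /=].
  have [fw|] := pselect (finite_graph (G w)).
    have [c wc] := finite_graph_code fw.
    by left; exists c => //; split=> //; exact: Qiso wc _.
  by move=> nf; right; split => //; exists (G w).
move=> [[c _ [/giso_sym wc q]]|[nf [F nF q]]]; first exact: Qiso wc _.
exact: Qinf nF _ _.
Qed.

Lemma measurable_graph_functional (X : graph -> R) :
  (forall F H, giso F H -> X F = X H) ->
  (forall F H, ~ finite_graph F -> ~ finite_graph H -> X F = X H) ->
  measurable_fun setT (fun w => X (G w)).
Proof.
move=> Xiso Xinf _ Y mY; rewrite setTI.
apply: (@measurable_graph_property (fun F => Y (X F))).
  by move=> F H /Xiso ->.
by move=> F H /Xinf XF /XF ->.
Qed.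

End Measurability.

Lemma vertex_mean_infinite (R : realType) (G : graph) (f : G -> R) :
  ~ finite_graph G -> vertex_mean f = 0.
Proof.
move=> nf; rewrite /vertex_mean /order /fset_set; case: pselect => // _.
by rewrite cardfs0 invr0 mulr0.
Qed.

Lemma kendall_tau_infinite (R : realType) (G : graph) (c : R) :
  ~ finite_graph G -> kendall_tau G c = c.
Proof. by move=> nf; rewrite /kendall_tau; case: asboolP => // -[]. Qed.

(** * Convergence of laws on the natural numbers *)

Section DiscreteConvergence.
Context d (T : measurableType d) (R : realType) (mu : probability T R).
Variable Z : T -> nat.
Hypothesis mZ : forall i, measurable [set w | Z w = i].
(** [L j] plays the role of the expectation under a probability law on nat, known only through
    monotonicity, linearity and total mass 1; [L_cvg] is pointwise convergence of these laws to the
    law of [Z]. *)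
Variable L : nat -> (nat -> R) -> R.
Hypothesis L_le : forall j u v, (forall i, u i <= v i) -> L j u <= L j v.
Hypothesis LD : forall j u v, L j (fun i => u i + v i) = L j u + L j v.
Hypothesis LZ : forall j c u, L j (fun i => c * u i) = c * L j u.
Hypothesis L1 : forall j, L j (fun=> 1) = 1.
Hypothesis L_cvg : forall i,
  L j (fun k => (k == i)%:R) @[j --> \oo] --> fine (mu [set w | Z w = i]).

Local Notation "\E u" := (\int[mu]_w (u (Z w))%:E)%E (at level 10, u at level 9).

Lemma measurable_fun_nat_comp (u : nat -> R) : measurable_fun setT (fun w => u (Z w)).
Proof.
move=> _ Y mY; rewrite setTI.
rewrite (_ : _ @^-1` Y = \bigcup_(i in [set i | Y (u i)]) [set w | Z w = i]).
  by apply: bigcup_measurable => i _; exact: mZ.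
by apply/seteqP; split=> [w Yw|w [i + wi]]; [exists (Z w)|rewrite /= -wi].
Qed.

Let measurableE (u : nat -> R) : measurable_fun setT (fun w => (u (Z w))%:E).
Proof. exact/measurable_EFinP/measurable_fun_nat_comp. Qed.

Let integral_series (u : nat -> R) : (forall i, 0 <= u i) ->
  (\E u = \sum_(i <oo) (u i * fine (mu [set w | Z w = i]))%:E)%E.
Proof.
move=> u0; have -> : [set: T] = \bigcup_i [set w | Z w = i].
  by apply/seteqP; split=> // w _; exists (Z w).
rewrite ge0_integral_bigcup//.
- apply: eq_eseriesr => i _; rewrite EFinM fineK ?fin_num_measure//.
  rewrite -integral_cst//.
  by apply: eq_integral => w; rewrite inE /= => ->.
- exact: measurable_funS (measurableE u).
- by move=> w _; rewrite lee_fin.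
- by move=> i j _ _ [w [/= <- <-]].
Qed.

Let L_sum j N (c : nat -> R) (f : nat -> nat -> R) :
  L j (fun k => \sum_(i < N) c i * f i k) = \sum_(i < N) c i * L j (f i).
Proof.
elim: N => [|N IH].
  rewrite big_ord0 -[RHS](mul0r (L j (fun=> 0))) -LZ.
  by congr (L j _); apply/funext => k; rewrite big_ord0 mul0r.
rewrite big_ord_recr/= -IH -LZ -LD; congr (L j _); apply/funext => k.
by rewrite big_ord_recr.
Qed.

(** Some partial sum of the series for the integral already exceeds [a]. It is the limit of the
    [L j]-means of a truncation of [u] to finitely many points, which lies below [u]. *)
Lemma discrete_fatou (u : nat -> R) (a : R) : (forall i, 0 <= u i) ->
  (a%:E < \E u)%E -> \forall j \near \oo, a < L j u.
Proof.
move=> u0; rewrite integral_series// => alt.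
have /existsNP[N] : ~ forall N,
    (\sum_(0 <= i < N) (u i * fine (mu [set w | Z w = i]))%:E <= a%:E)%E.
  move=> h; move: alt; rewrite ltNge => /negP; apply.
  apply: lime_le; last by near=> N; exact: h.
  by apply: is_cvg_nneseries => i _ _; rewrite lee_fin mulr_ge0// fine_ge0.
move=> /negP; rewrite -ltNge big_mkord sumEFin lte_fin => aN.
have : \sum_(i < N) u i * L j (fun k => (k == i)%:R) @[j --> \oo] -->
    \sum_(i < N) u i * fine (mu [set w | Z w = i]).
  apply: cvg_big => [|i _]; [exact: add_continuous|apply: cvgMl_tmp; exact: L_cvg].
move=> /cvgr_gt /(_ _ aN); apply: filterS => j /lt_le_trans; apply.
rewrite -(L_sum j N u (fun i k => (k == i)%:R)); apply: L_le => k.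
have [kN|Nk] := ltnP k N.
  rewrite (bigD1 (Ordinal kN))//= eqxx mulr1 big1 ?addr0// => i.
  by rewrite -val_eqE/= eq_sym => /negbTE ->; rewrite mulr0.
rewrite big1// => i _; rewrite gtn_eqF ?mulr0//.
exact: leq_trans Nk.
Unshelve. all: by end_near. Qed.

Section UniformlyIntegrable.
Variable u : nat -> R.
Hypothesis u0 : forall i, 0 <= u i.
Hypothesis uUI : forall delta : R, 0 < delta ->
  exists K : R, \forall j \near \oo, L j (fun i => u i * (K < u i)%R%:R) <= delta.

Let L_cst j c : L j (fun=> c) = c.
Proof.
rewrite -[RHS]mulr1 -(L1 j) -LZ; congr (L j _).
by apply/funext => i; rewrite mulr1.
Qed.

Let UI_nonneg (delta : R) : 0 < delta -> exists2 K : R, 0 <= K &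
  \forall j \near \oo, L j (fun i => u i * (K < u i)%R%:R) <= delta.
Proof.
move=> /uUI[K hK]; exists (Num.max K 0); first by rewrite le_max lexx orbT.
apply: filterS hK => j; apply: le_trans; apply: L_le => i.
by apply: ler_wpM2l => //; rewrite ler_nat gt_max; do 2 case: (_ < u i)%R.
Qed.

(** If the integral were infinite, Fatou would force [L j u] above [K + 1] eventually, whereas
    splitting [u] at [K] bounds it by [K + 1]. *)
Lemma discrete_integral_fin : (\E u < +oo)%E.
Proof.
have [K K0 hK] := UI_nonneg ltr01.
rewrite ltNge; apply/negP => h.
have : ((K + 1)%:E < \E u)%E by apply: lt_le_trans h; rewrite ltry.
move=> /(discrete_fatou u0) h2.
have [j [/= + jK]] := filter_ex (filterI h2 hK).
apply/negP; rewrite -leNgt.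
apply: (@le_trans _ _ (L j (fun i => K + u i * (K < u i)%R%:R))).
  apply: L_le => i; case: (ltP K (u i)) => uK; first by rewrite mulr1 lerDr.
  by rewrite mulr0 addr0.
by rewrite LD L_cst lerD2l.
Qed.

(** Fatou for [u] is the lower bound. For the upper bound Fatou is applied to [K - b], where [b] is
    [u] replaced by 0 above [K]; uniform integrability controls the part removed. *)
Lemma discrete_vitali : L j u @[j --> \oo] --> fine (\E u).
Proof.
have ufin : \E u \is a fin_num.
  by rewrite ge0_fin_numE ?discrete_integral_fin// integral_ge0// => w _; rewrite lee_fin.
apply/cvgrPdist_le => eps eps0.
have e2 : 0 < eps / 2 by rewrite divr_gt0.
have [K K0 hK] := UI_nonneg e2.
have lower : \forall j \near \oo, fine (\E u) - eps < L j u.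
  by apply: discrete_fatou => //; rewrite EFinB fineK// lteBlDr// lteDl// lte_fin.
pose b i := u i * (u i <= K)%R%:R.
have b0 i : 0 <= b i by rewrite mulr_ge0.
have bu i : b i <= u i by rewrite /b; case: (u i <= K); rewrite ?mulr1 ?mulr0.
have bK i : b i <= K by rewrite /b; case: (leP (u i) K) => h; rewrite ?mulr1 ?mulr0.
have ub : (\E b <= \E u)%E.
  apply: ge0_le_integral => //.
  - by move=> w _; rewrite lee_fin.
  - by move=> w _; rewrite lee_fin.
have bfin : \E b \is a fin_num.
  rewrite ge0_fin_numE; first exact: le_lt_trans ub discrete_integral_fin.
  by apply: integral_ge0 => w _; rewrite lee_fin.
have Kb : (\E (fun i => K - b i)%R + \E b = K%:E)%E.
  rewrite -ge0_integralD//.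
  - rewrite (eq_integral (cst K%:E)) => [|w _].
      by rewrite integral_cst// [X in (_ * X)%E]probability_setT mule1.
    by rewrite -EFinD subrK.
  - by move=> w _; rewrite lee_fin subr_ge0.
  - exact: (measurableE (fun i => K - b i)).
  - by move=> w _; rewrite lee_fin.
have upper : \forall j \near \oo, K - fine (\E u) - eps / 2 < L j (fun i => K - b i).
  apply: discrete_fatou => [i|]; first by rewrite subr_ge0.
  rewrite -(addeK (\E (fun i => K - b i)%R) bfin) Kb !EFinB fineK//.
  rewrite -(fineK ufin) -(fineK bfin) -!EFinB lte_fin.
  have : fine (\E b) <= fine (\E u) by apply: fine_le.
  lra.
near=> j; have jl : fine (\E u) - eps < L j u by near: j.
have ju : K - fine (\E u) - eps / 2 < L j (fun i => K - b i) by near: j.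
have jK : L j (fun i => u i * (K < u i)%R%:R) <= eps / 2 by near: j.
have eK : L j (fun i => K - b i) + L j b = K.
  by rewrite -LD -[RHS](L_cst j); congr (L j _); apply/funext => i; rewrite subrK.
have eu : L j u = L j b + L j (fun i => u i * (K < u i)%R%:R).
  rewrite -LD; congr (L j _); apply/funext => i; rewrite /b -mulrDr.
  by case: (ltP K (u i)) => _; rewrite ?addr0 ?add0r mulr1.
rewrite ler_norml; apply/andP; split; lra.
Unshelve. all: by end_near. Qed.

End UniformlyIntegrable.

End DiscreteConvergence.

(** * Vertex averages of finite graphs *)

Section VertexMean.
Variables (R : realType) (G : graph).
Hypothesis finG : finite_graph G.
Hypothesis neG : [set: G] !=set0.
Implicit Types f g : G -> R.

Let order_neq0 : (order G)%:R != 0 :> R.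
Proof.
rewrite pnatr_eq0 /order; apply/negP => /eqP/cardfs0_eq e.
have [v _] := neG; have : v \in fset_set [set: G] by rewrite in_fset_set// inE.
by rewrite e.
Qed.

Lemma vertex_mean_le f g : (forall v, f v <= g v) ->
  vertex_mean f <= vertex_mean g.
Proof.
move=> fg; rewrite /vertex_mean !fsbig_finite// ler_wpM2r ?invr_ge0//.
exact: ler_sum.
Qed.

Lemma vertex_meanD f g :
  vertex_mean (fun v => f v + g v) = vertex_mean f + vertex_mean g.
Proof. by rewrite /vertex_mean !fsbig_finite// big_split mulrDl. Qed.

Lemma vertex_meanZ c f : vertex_mean (fun v => c * f v) = c * vertex_mean f.
Proof. by rewrite /vertex_mean -mulr_fsumr mulrA. Qed.

Lemma vertex_mean1 : vertex_mean (fun _ : G => 1) = 1 :> R.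
Proof.
rewrite /vertex_mean fsbig_finite// big_const_seq count_predT iter_addr_0.
by rewrite divff.
Qed.

Lemma sum_darts (f : G -> G -> R) : \sum_(e \in darts (G := G)) f e.1 e.2 =
  \sum_(v \in [set: G]) \sum_(w \in nbrs v) f v w.
Proof.
transitivity (\sum_(e \in [set: G] `*` [set: G]) 
  if e \in darts (G := G) then f e.1 e.2 else 0).
  by rewrite -fsbig_mkcondr setXTT setTI.
rewrite -(@pair_fsbig _ _ _ _ _ _ _ (fun v w =>
  if (v, w) \in darts (G := G) then f v w else 0))//.
apply: eq_fsbigr => v _; rewrite -[in RHS](setTI (nbrs v)) fsbig_mkcondr.
by apply: eq_fsbigr => w _; rewrite /darts /nbrs !mem_setE.
Qed.

Lemma card_fsum (T : choiceType) (A : set T) :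
  \sum_(x \in A) (1 : R) = #|` fset_set A|%fset%:R.
Proof.
have [fA|nA] := pselect (finite_set A).
  by rewrite fsbig_finite// big_const_seq count_predT iter_addr_0.
(* For infinite [A] the constant 1 has infinite support on [A], and the sum takes the default value
   0, like the cardinal. *)
rewrite fsbig_dflt; first by rewrite /fset_set; case: pselect.
rewrite (_ : _ `&` _ = A)//; apply/seteqP; split => [x []//|x Ax]; split => //=.
by apply/eqP; rewrite oner_eq0.
Qed.

Lemma nbr_sum_degE (u : nat -> R) (v : G) :
  nbr_sum (fun a _ => u a) v = (deg v)%:R * u (deg v).
Proof.
rewrite /nbr_sum /deg -card_fsum mulr_fsuml.
by apply: eq_fsbigr => w _; rewrite mul1r.
Qed.

Lemma ndartsE : (ndarts G)%:R = \sum_(v \in [set: G]) nbr_sum (fun _ _ => 1 : R) v.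
Proof. by rewrite /ndarts -card_fsum (sum_darts (fun _ _ => 1)). Qed.

(** The sum over darts and the number of darts are both vertex sums; dividing each by the nonzero
    order leaves their quotient unchanged. *)
Lemma dart_meanE (phi : nat -> nat -> R) :
  dart_mean (fun u v : G => phi (deg u) (deg v)) =
  vertex_mean (nbr_sum phi (G:=G)) / vertex_mean (nbr_sum (fun _ _ => 1) (G:=G)).
Proof.
rewrite /dart_mean /vertex_mean ndartsE (sum_darts (fun u v => phi (deg u) (deg v))).
by rewrite invf_div mulrA divfK// mulrC.
Qed.

(** Reversing all darts exchanges the two sums. This reduces darts whose head has large degree to
    darts whose origin does. *)
Lemma vertex_mean_swap (phi : nat -> nat -> R) :
  vertex_mean (nbr_sum phi (G := G)) =
  vertex_mean (nbr_sum (fun a b => phi b a) (G := G)).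
Proof.
congr (_ / _); rewrite /nbr_sum.
have E (f : G -> G -> R) : \sum_(v \in [set: G]) \sum_(w \in nbrs v) f v w =
    \sum_(v <- fset_set [set: G]) \sum_(w <- fset_set [set: G] | adj v w) f v w.
  rewrite fsbig_finite//; apply: eq_bigr => v _.
  rewrite -(setTI (nbrs v)) fsbig_mkcondr fsbig_finite// -big_mkcond.
  by apply: eq_bigl => w; rewrite mem_setE.
rewrite !E (exchange_big_dep xpredT)//=; apply: eq_bigr => w _.
by apply: eq_bigl => v; rewrite adj_sym.
Qed.

Lemma nbr_sum_le (phi psi : nat -> nat -> R) (v : G) :
  (forall a b, phi a b <= psi a b) -> nbr_sum phi v <= nbr_sum psi v.
Proof.
move=> h; have fv := finite_graph_locally_finite finG v.
by rewrite /nbr_sum !fsbig_finite//; apply: ler_sum.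
Qed.

Lemma nbr_sumD (phi psi : nat -> nat -> R) (v : G) :
  nbr_sum (fun a b => phi a b + psi a b) v = nbr_sum phi v + nbr_sum psi v.
Proof.
have fv := finite_graph_locally_finite finG v.
by rewrite /nbr_sum !fsbig_finite// big_split.
Qed.

Lemma nbr_sumZ c (phi : nat -> nat -> R) (v : G) :
  nbr_sum (fun a b => c * phi a b) v = c * nbr_sum phi v.
Proof. by rewrite /nbr_sum mulr_fsumr. Qed.

Lemma tail_degE (K : R) :
  @tail_deg R K G = nbr_sum (fun a _ => (K < a%:R)%R%:R) (G:=G).
Proof. by apply/funext => v; rewrite nbr_sum_degE. Qed.

End VertexMean.

(** * Convergence of averages of local functionals *)

Section BallType.

(* The junk value 0 is taken only when the ball is infinite. *)
Definition ball_type (X : rooted_graph) : nat :=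
  xget 0%N [set i | riso (ball_graph 2 X) (rooted_type i) /\
    forall j, riso (ball_graph 2 X) (rooted_type j) -> (i <= j)%N].

Lemma ball_typeP (X : rooted_graph) : locally_finite X ->
  riso (ball_graph 2 X) (rooted_type (ball_type X)) /\
    forall j, riso (ball_graph 2 X) (rooted_type j) -> (ball_type X <= j)%N.
Proof.
move=> /(@ball_rooted_type 2)[i0 hi0].
have ex : exists i, `[< riso (ball_graph 2 X) (rooted_type i) >].
  by exists i0; apply/asboolP.
rewrite /ball_type; case: xgetP => [i _ //|/(_ (ex_minn ex)) []].
case: ex_minnP => i /asboolP hi him; split=> // j hj.
by apply: him; apply/asboolP.
Qed.

Lemma nbr_sum_ball_type (R : realType) phi (X : rooted_graph) : locally_finite X ->
  nbr_sum phi (root X) = nbr_sum phi (root (rooted_type (ball_type X))) :> R.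
Proof. by move=> /ball_typeP[/(nbr_sum_riso phi) <- _]; rewrite nbr_sum_ball. Qed.

(** As [rooted_type] has repetitions, the least index stands for its isomorphism class; on locally
    finite graphs [ball_type] takes no other values. *)
Definition first_type i := forall j, riso (rooted_type i) (rooted_type j) -> (i <= j)%N.

Lemma ball_type_eq (X : rooted_graph) i : locally_finite X ->
  ball_type X = i <-> riso (ball_graph 2 X) (rooted_type i) /\ first_type i.
Proof.
move=> /ball_typeP[h hm]; split=> [<-|[hi fi]].
  by split=> // j hj; apply: hm; exact: riso_trans h hj.
apply/eqP; rewrite eqn_leq hm//= fi//.
exact: riso_trans (riso_sym hi) h.
Qed.

Lemma finite_rooted_type_graph i : finite_graph (rooted_type i).
Proof. exact: finite_finset. Qed.

End BallType.

Section LocalConvergence.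
Context d (T : measurableType d) (R : realType) (mu : probability T R).
Variable Go : T -> rooted_graph.
Hypothesis hGo : random_rooted_graph Go.
Variable F : nat -> graph.
Hypothesis finF : forall j, finite_graph (F j).
Hypothesis neF : forall j, [set: F j] !=set0.
Hypothesis F_cvg : forall i,
  vertex_mean (fun v : F j =>
    (`[< riso (ball_graph 2 (Rooted v)) (rooted_type i) >])%:R) @[j --> \oo] -->
  fine (mu [set w | riso (ball_graph 2 (Go w)) (rooted_type i)]).
Hypothesis F_UI : forall delta : R, 0 < delta ->
  exists K : R, \forall j \near \oo, vertex_mean (@tail_deg R K (F j)) <= delta.

Let lfF j v : locally_finite (@Rooted (F j) v).
Proof. exact: (finite_graph_locally_finite (finF j)). Qed.

Let lfGo w : locally_finite (Go w).
Proof. by have [_ /(_ w)[]] := hGo. Qed.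

Let Z w := ball_type (Go w).

(** Level sets of the ball type become events generating the local topology, which gives
    measurability and connects [F_cvg] with the hypothesis on laws on nat. *)
Let Z_set i : [set w | Z w = i] =
  if `[< first_type i >] then [set w | riso (ball_graph 2 (Go w)) (rooted_type i)]
  else set0.
Proof.
case: asboolP => fi; apply/seteqP; split => w //=.
- by move=> /ball_type_eq[].
- by move=> h; apply/ball_type_eq.
- by move=> /ball_type_eq[].
Qed.

Lemma measurable_ball_type i : measurable [set w | ball_type (Go w) = i].
Proof.
by rewrite [X in measurable X]Z_set; case: asboolP => // _; have [h _] := hGo; exact: h.
Qed.

Lemma measurable_nbr_sum (phi : nat -> nat -> R) :
  measurable_fun setT (fun w => nbr_sum phi (root (Go w))).
Proof.
have := measurable_fun_nat_comp measurable_ball_type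
  (fun i => nbr_sum phi (root (rooted_type i))).
by congr (measurable_fun _ _); apply/funext => w; rewrite [RHS]nbr_sum_ball_type.
Qed.

Let L j (u : nat -> R) := vertex_mean (fun v : F j => u (ball_type (Rooted v))).

Let L_cvg i : L j (fun k => (k == i)%:R) @[j --> \oo] --> fine (mu [set w | Z w = i]).
Proof.
rewrite Z_set; case: asboolP => fi.
  rewrite (_ : (fun j => L j _) = fun j => vertex_mean (fun v : F j =>
    (`[< riso (ball_graph 2 (Rooted v)) (rooted_type i) >])%:R)); first exact: F_cvg.
  apply/funext => j; congr (vertex_mean _); apply/funext => v; congr (_%:R).
  congr nat_of_bool; apply/eqP/asboolP.
    by move=> /(ball_type_eq _ (@lfF j v))[].
  by move=> h; apply/(ball_type_eq _ (@lfF j v)).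
(* An index that is not the least of its class is never attained, so both the frequencies and the
   limit vanish. *)
rewrite measure0 (_ : (fun j => L j _) = fun=> 0); first exact: cvg_cst.
apply/funext => j; rewrite /L (_ : (fun v => _) = fun=> 0 * 0).
  by rewrite vertex_meanZ mul0r.
apply/funext => v; rewrite mul0r; case: eqP => // /(ball_type_eq _ (@lfF j v))[].
by [].
Qed.

Lemma vertex_mean_ball_type (phi : nat -> nat -> R) j :
  L j (fun i => nbr_sum phi (root (rooted_type i))) =
  vertex_mean (nbr_sum phi (G := F j)).
Proof.
congr (vertex_mean _); apply/funext => v.
exact/esym/(@nbr_sum_ball_type _ _ (Rooted v))/lfF.
Qed.

Section Dominated.
Variables (phi : nat -> nat -> R) (C : R).
Hypothesis phi0 : forall a b, 0 <= phi a b.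
Hypothesis phiC : forall a b, phi a b <= C.

Let u i := nbr_sum phi (root (rooted_type i)).

Let u0 i : 0 <= u i.
Proof. exact: fsumr_ge0. Qed.

Let u_le i : u i <= C * (deg (root (rooted_type i)))%:R.
Proof.
have := @nbr_sum_le R _ (@finite_rooted_type_graph i) phi (fun _ _ => C)
  (root (rooted_type i)) phiC.
by rewrite (nbr_sum_degE (fun=> C)) mulrC.
Qed.

Let L_le j f g : (forall i, f i <= g i) -> L j f <= L j g.
Proof. by move=> fg; apply: vertex_mean_le. Qed.

Let LD j f g : L j (fun i => f i + g i) = L j f + L j g.
Proof. exact: vertex_meanD. Qed.
Let LZ j c f : L j (fun i => c * f i) = c * L j f.
Proof. exact: vertex_meanZ. Qed.
Let L1 j : L j (fun=> 1) = 1.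
Proof. exact: vertex_mean1. Qed.

(** Since [u] is at most [C] times the degree, [u] exceeding [(C + 1) * K] forces a degree above
    [K]. The factor [C + 1] stays positive when [C] is 0. *)
Let uUI (delta : R) : 0 < delta -> exists K : R,
  \forall j \near \oo, L j (fun i => u i * (K < u i)%R%:R) <= delta.
Proof.
have C0 : 0 <= C by exact: le_trans (phiC 0 0).
have C1 : 0 < C + 1 by rewrite ltr_wpDl.
move=> d0; have [K hK] := F_UI (divr_gt0 d0 C1).
exists ((C + 1) * K); apply: filterS hK => j; rewrite ler_pdivlMr// mulrC.
apply: le_trans; rewrite tail_degE -vertex_mean_ball_type -LZ.
apply: L_le => i; rewrite (nbr_sum_degE (fun a => (K < a%:R)%R%:R)).
set h := (deg _)%:R; have h0 : 0 <= h by exact: ler0n.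
have uh : u i <= (C + 1) * h by rewrite (le_trans (u_le i))// ler_wpM2r// lerDl.
case: (ltP ((C + 1) * K) (u i)) => [Ku|_]; last first.
  by rewrite mulr0 !mulr_ge0// ?ler0n// ltW.
have : (C + 1) * K < (C + 1) * h by exact: lt_le_trans uh.
by rewrite ltr_pM2l// => ->; rewrite !mulr1.
Qed.

Lemma integral_nbr_sum_fin :
  (\int[mu]_w (nbr_sum phi (root (Go w)))%:E < +oo)%E.
Proof.
under eq_integral => w _ do rewrite nbr_sum_ball_type//.
exact: (discrete_integral_fin measurable_ball_type L_le LD LZ L1 L_cvg u0 uUI).
Qed.

Lemma vertex_mean_nbr_sum_cvg :
  vertex_mean (nbr_sum phi (G := F j)) @[j --> \oo] -->
  fine (\int[mu]_w (nbr_sum phi (root (Go w)))%:E).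
Proof.
under eq_integral => w _ do rewrite nbr_sum_ball_type//.
rewrite (_ : (fun j => _) = fun j => L j u); last first.
  by apply/funext => j; rewrite vertex_mean_ball_type.
exact: (discrete_vitali measurable_ball_type L_le LD LZ L1 L_cvg u0 uUI).
Qed.

End Dominated.

End LocalConvergence.

(** * Limit expectations as integrals of neighbour sums *)

Section RootExpectation.
Context d (T : measurableType d) (R : realType) (mu : probability T R).
Variable Go : T -> rooted_graph.
Hypothesis hGo : random_rooted_graph Go.

Lemma E_root_nbrE (f : int -> int -> R) : E_root_nbr mu Go f =
  fine (\int[mu]_w (nbr_sum (fun a b : nat => f a%:Z b%:Z) (root (Go w)))%:E).
Proof.
rewrite /E_root_nbr unlock; congr fine; apply: eq_integral => w _; congr (_%:E).
rewrite /nbr_mean /nbr_sum /root_deg mulrCA.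
have [d0|d0] := eqVneq (deg (root (Go w))) 0%N; last first.
  by rewrite mulfV ?mulr1// pnatr_eq0.
(* Local finiteness matters here: [deg] is 0 also for an infinite neighbourhood, on which the sum
   need not be trivial. *)
rewrite d0 mul0r mulr0 (_ : nbrs (root (Go w)) = set0) ?fsbig_set0//.
have [_ /(_ w)[_ lf]] := hGo.
by apply: fset_set_set0; [exact: lf|exact: cardfs0_eq].
Qed.

Lemma E_root_degE : E_root_deg mu Go =
  fine (\int[mu]_w (nbr_sum (fun _ _ => 1) (root (Go w)))%:E).
Proof.
rewrite /E_root_deg unlock; congr fine; apply: eq_integral => w _; congr (_%:E).
by rewrite (nbr_sum_degE (fun=> 1)) mulr1.
Qed.

End RootExpectation.

(** * Kendall's tau along a deterministic sequence *)

Section KendallConvergence.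
Context d (T : measurableType d) (R : realType) (mu : probability T R).
Variable Go : T -> rooted_graph.
Hypothesis hGo : random_rooted_graph Go.
Hypothesis hdeg : (0 < mu [set w | (1 <= root_deg Go w)%N])%E.
Variable F : nat -> graph.
Hypothesis finF : forall j, finite_graph (F j).
Hypothesis neF : forall j, [set: F j] !=set0.
Hypothesis F_cvg : forall i,
  vertex_mean (fun v : F j =>
    (`[< riso (ball_graph 2 (Rooted v)) (rooted_type i) >])%:R) @[j --> \oo] -->
  fine (mu [set w | riso (ball_graph 2 (Go w)) (rooted_type i)]).
Hypothesis F_UI : forall delta : R, 0 < delta ->
  exists K : R, \forall j \near \oo, vertex_mean (@tail_deg R K (F j)) <= delta.

Let V j (phi : nat -> nat -> R) := vertex_mean (nbr_sum phi (G := F j)).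
Let E (phi : nat -> nat -> R) := fine (\int[mu]_w (nbr_sum phi (root (Go w)))%:E).
Let one (a b : nat) : R := 1.

Let V_cvg phi C : (forall a b, 0 <= phi a b) -> (forall a b, phi a b <= C) ->
  V j phi @[j --> \oo] --> E phi.
Proof. exact: (vertex_mean_nbr_sum_cvg hGo finF neF F_cvg F_UI). Qed.

Let V_le j phi psi : (forall a b, phi a b <= psi a b) -> V j phi <= V j psi.
Proof. by move=> h; apply: vertex_mean_le => // v; exact: nbr_sum_le. Qed.

Let VD j phi psi : V j (fun a b => phi a b + psi a b) = V j phi + V j psi.
Proof.
rewrite /V -vertex_meanD//; congr vertex_mean; apply/funext => v.
by rewrite nbr_sumD.
Qed.

Let VZ j c phi : V j (fun a b => c * phi a b) = c * V j phi.
Proof.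
rewrite /V -vertex_meanZ//; congr vertex_mean; apply/funext => v.
by rewrite nbr_sumZ.
Qed.

Let V_ge0 j phi : (forall a b, 0 <= phi a b) -> 0 <= V j phi.
Proof.
by move=> h; rewrite -(mul0r (V j phi)) -VZ; apply: V_le => a b; rewrite mul0r.
Qed.

(** The root degree dominates the indicator of being at least 1, whose integral is positive by
    [hdeg]; finiteness of the integral lets [fine] preserve positivity. *)
Let E_one_gt0 : 0 < E one.
Proof.
rewrite /E fine_gt0//; apply/andP; split; last first.
  exact: (integral_nbr_sum_fin hGo finF neF F_cvg F_UI (C := 1)).
apply: lt_le_trans hdeg _.
set A := [set w | _].
have mA : measurable A.
  have := measurable_nbr_sum hGo one measurableT (measurable_itv `[(1 : R), +oo[).
  rewrite setTI; congr measurable; apply/seteqP; split=> w; rewrite /A /=.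
    by rewrite (nbr_sum_degE (fun=> 1)) mulr1 in_itv/= andbT ler1n.
  by rewrite (nbr_sum_degE (fun=> 1)) mulr1 in_itv/= andbT ler1n.
rewrite -[X in (mu X <= _)%E](setIT A) -integral_indic//.
apply: ge0_le_integral => //.
- by apply/measurable_EFinP; exact: measurable_indic.
- by apply/measurable_EFinP; exact: measurable_nbr_sum.
- move=> w _; rewrite lee_fin (nbr_sum_degE (fun=> 1)) mulr1 indicE ler_nat.
  by case: (boolP (w \in A)) => //; rewrite inE.
Qed.

Let V_one_cvg : V j one @[j --> \oo] --> E one.
Proof. by apply: (V_cvg (C := 1)) => a b; rewrite ?ler01 ?lexx. Qed.

Let below (k l : int) (a b : nat) : R := ((a%:Z <= k) && (b%:Z <= l))%R%:R.

Let below01 k l a b : 0 <= below k l a b <= 1.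
Proof. by rewrite /below ler0n lern1 leq_b1. Qed.

Let H_cvg k l : H_G R (F j) k l @[j --> \oo] --> H_mu mu Go k l.
Proof.
rewrite (_ : H_mu mu Go k l = E (below k l) * (E one)^-1); last first.
  rewrite /H_mu E_root_degE// E_root_nbrE//; congr (fine _ / _).
  apply: eq_integral => w _; congr (_%:E); rewrite /nbr_sum.
  by apply: eq_fsbigr => v _; rewrite /below -mulnb natrM.
rewrite (_ : (fun j => _) = fun j => V j (below k l) * (V j one)^-1); last first.
  by apply/funext => j; rewrite /H_G (dart_meanE (finF j) (neF j) (below k l)).
apply: cvgM; first by apply: (V_cvg (C := 1)) => a b; have /andP[] := below01 k l a b.
by apply: cvgV; rewrite ?gt_eqF.
Qed.

Let H_bounds j k l : 0 <= H_G R (F j) k l <= 1.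
Proof.
rewrite /H_G (dart_meanE (finF j) (neF j) (below k l))// -/(V j _) -/(V j one).
have V0 : 0 <= V j (below k l) by apply: V_ge0 => a b; have /andP[] := below01 k l a b.
have V1 : V j (below k l) <= V j one by apply: V_le => a b; have /andP[] := below01 k l a b.
have V2 : 0 <= V j one by exact: le_trans V1.
(* Without darts the quotient is 0, since the inverse of 0 is 0. *)
rewrite divr_ge0//=; have [->|] := eqVneq (V j one) 0.
  by rewrite invr0 mulr0 ler01.
by move=> n0; rewrite ler_pdivrMr ?mul1r// lt_neqAle eq_sym n0.
Qed.

Let calH_cvg k l : calH_G R (F j) k l @[j --> \oo] --> calH_mu mu Go k l.
Proof. by rewrite /calH_mu; do ! apply: cvgD; exact: H_cvg. Qed.

Let calH_bounds j k l : 0 <= calH_G R (F j) k l <= 4.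
Proof.
rewrite /calH_G.
have /andP[? ?] := H_bounds j k l.
have /andP[? ?] := H_bounds j (k - 1) l.
have /andP[? ?] := H_bounds j k (l - 1).
have /andP[? ?] := H_bounds j (k - 1) (l - 1).
apply/andP; split; lra.
Qed.

(** The bounds are inherited from the finite graphs through the limit. *)
Let calH_mu_bounds k l : 0 <= calH_mu mu Go k l <= 4.
Proof.
apply/andP; split.
  apply: (cvgr_to_ge (@calH_cvg k l)).
  by apply: nearW => j; have /andP[] := calH_bounds j k l.
apply: (cvgr_to_le (@calH_cvg k l)).
by apply: nearW => j; have /andP[] := calH_bounds j k l.
Qed.

Let psi_ j (a b : nat) := calH_G R (F j) a%:Z b%:Z.
Let psi (a b : nat) := calH_mu mu Go a%:Z b%:Z.
(** A finite sum instead of a maximum over degrees below [N]: it dominates each deviation and tends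
    to 0 term by term. *)
Let dev N j := \sum_(a < N) \sum_(b < N) `|psi_ j a b - psi a b|.

Let dev_cvg N : dev N j @[j --> \oo] --> 0.
Proof.
rewrite [X in _ --> X](_ : _ = \sum_(a < N) \sum_(b < N) 0); last first.
  by rewrite big1// => a _; rewrite big1.
apply: cvg_big => [|a _]; first exact: add_continuous.
apply: cvg_big => [|b _]; first exact: add_continuous.
by rewrite -(@normr0 _ R); apply: cvg_norm; apply/subr_cvg0; exact: calH_cvg.
Qed.

(** If both degrees are below [N], the deviation is a term of [dev N j]. Otherwise it is at most 4,
    as both values lie in [0, 4], and one of the indicators is 1. *)
Let dev_le N j a b : `|psi_ j a b - psi a b| <=
  dev N j * one a b + 4 * ((N <= a)%N%:R + (N <= b)%N%:R).
Proof.
have dev0 : 0 <= dev N j by apply: sumr_ge0 => ? _; apply: sumr_ge0.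
have /andP[? ?] := calH_bounds j a b.
have /andP[? ?] := calH_mu_bounds a b.
have n4 : `|psi_ j a b - psi a b| <= 4.
  by rewrite ler_norml /psi_ /psi; apply/andP; split; lra.
rewrite mulr1; case: (leqP N a) => [_|aN].
  by rewrite (le_trans n4)// -[leLHS]add0r lerD// mulrDr mulr1 lerDl mulr_ge0.
case: (leqP N b) => [_|bN].
  by rewrite add0r mulr1 (le_trans n4)// lerDr.
rewrite addr0 mulr0 addr0 /dev (bigD1 (Ordinal aN))//= (bigD1 (Ordinal bN))//=.
apply: ler_wpDr; last by apply: ler_wpDr => //; apply: sumr_ge0.
by apply: sumr_ge0 => ? _; apply: sumr_ge0.
Qed.

(* calH_G converges uniformly on degrees below N; the remaining darts have an
   endpoint of degree at least N, and reversing darts bounds their number by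
   twice the tail of the degree. *)
Let V_psi_cvg : V j (psi_ j) - V j psi @[j --> \oo] --> 0.
Proof.
apply/cvgrPdist_le => eps eps0.
(* The tail enters [V j B] with factor 4 for each of the two endpoints, so [eps / 16] contributes at
   most [eps / 2]. *)
have [K hK] := F_UI (divr_gt0 eps0 (ltr0n _ 16 : 0 < 16)).
pose N := (Num.truncn K).+1.
have KN : K < N%:R by exact: truncnS_gt.
have dV : dev N j * V j one @[j --> \oo] --> 0.
  by rewrite -(mul0r (E one)); apply: cvgM.
have e2 : 0 < eps / 2 by rewrite divr_gt0.
have hdV : \forall j \near \oo, dev N j * V j one < eps / 2.
  by move/cvgr_lt : dV => /(_ _ e2).
near=> j; have hj : vertex_mean (@tail_deg R K (F j)) <= eps / 16 by near: j.
have hd : dev N j * V j one < eps / 2 by near: j.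
have tN : V j (fun a _ => (N <= a)%N%:R) <= eps / 16.
  apply: le_trans hj; rewrite tail_degE; apply: V_le => a b.
  rewrite ler_nat; case: (leqP N a) => // Na; rewrite (lt_le_trans KN)//.
  by rewrite ler_nat.
pose B a b := dev N j * one a b + 4 * ((N <= a)%N%:R + (N <= b)%N%:R).
have VB : V j B <= eps.
  have Vswap : V j (fun _ b => (N <= b)%N%:R) = V j (fun a _ => (N <= a)%N%:R).
    exact: (vertex_mean_swap (finF j)).
  by rewrite VD VZ VZ VD Vswap; lra.
have le1 : V j (psi_ j) <= V j psi + V j B.
  rewrite -VD; apply: V_le => a b; rewrite -lerBlDl.
  exact: le_trans (ler_norm _) (dev_le N j a b).
have le2 : V j psi <= V j (psi_ j) + V j B.
  rewrite -VD; apply: V_le => a b; rewrite -lerBlDl.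
  by apply: le_trans (dev_le N j a b); rewrite distrC ler_norm.
rewrite sub0r normrN ler_norml; apply/andP; split; lra.
Unshelve. all: by end_near. Qed.

Lemma kendall_tau_cvg (c : R) : kendall_tau (F j) c @[j --> \oo] -->
  E_root_nbr mu Go (calH_mu mu Go) / E_root_deg mu Go - 1.
Proof.
rewrite E_root_degE// E_root_nbrE// -/(E psi) -/(E one).
have num : V j (psi_ j) @[j --> \oo] --> E psi.
  rewrite (_ : (fun j => _) = (fun j => (V j (psi_ j) - V j psi) + V j psi)); last first.
    by apply/funext => j; rewrite subrK.
  rewrite -[E psi]add0r; apply: cvgD => //; apply: (V_cvg (C := 4)) => a b.
    by have /andP[] := calH_mu_bounds a b.
  by have /andP[] := calH_mu_bounds a b.
have lim : V j (psi_ j) / V j one - 1 @[j --> \oo] --> E psi / E one - 1.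
  apply: cvgB; last exact: cvg_cst.
  by apply: cvgM => //; apply: cvgV; rewrite ?gt_eqF.
apply: cvg_trans lim; apply: near_eq_cvg.
(* A positive mean degree provides an edge, so that eventually tau is given by its formula and not
   by [c]. *)
have : \forall j \near \oo, 0 < V j one by move/cvgr_gt : V_one_cvg => /(_ _ E_one_gt0).
apply: filterS => j Vpos.
rewrite /kendall_tau; case: asboolP => [_|nd].
  by rewrite (dart_meanE (finF j) (neF j) (psi_ j)).
exfalso; apply: nd; split => //; apply/set0P; apply: contraTneq Vpos => d0.
have : ndarts (F j) = 0%N by rewrite /ndarts d0 fset_set0 cardfs0.
move=> /(congr1 (fun n => n%:R : R)); rewrite ndartsE// => n0.
by rewrite /V /vertex_mean n0 mul0r ltxx.
Qed.

End KendallConvergence.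

(** * Reduction to deterministic sequences *)

Section TailMarkov.
Context d (T : measurableType d) (R : realType) (P : probability T R).
Variable G : T -> graph.
Hypothesis hG : random_finite_graph P G.

Lemma measurable_vertex_mean_ball (H : rooted_graph) r (e p : R) :
  measurable [set w | e < `|vertex_mean (fun v : G w =>
     (`[< riso (ball_graph r (Rooted v)) H >])%:R) - p|].
Proof.
apply: (measurable_graph_property hG (Q := fun F => e < `|vertex_mean (fun v : F =>
     (`[< riso (ball_graph r (Rooted v)) H >])%:R) - p|)) => F F'.
  by move=> /vertex_mean_ball_giso ->.
by move=> nF nF'; rewrite !vertex_mean_infinite.
Qed.

Lemma measurable_kendall_tau (c e p : R) :
  measurable [set w | e < `|kendall_tau (G w) c - p|].
Proof.
apply: (measurable_graph_property hG (Q := fun F =>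
  e < `|kendall_tau F c - p|)) => F F'.
  by move=> /kendall_tau_giso ->.
by move=> nF nF'; rewrite !kendall_tau_infinite.
Qed.

Lemma vertex_mean_tail_ge0 (K : R) (F : graph) : 0 <= vertex_mean (@tail_deg R K F).
Proof.
by rewrite divr_ge0// fsumr_ge0// => v _; rewrite mulr_ge0.
Qed.

Lemma measurable_vertex_mean_tail (K : R) :
  measurable_fun setT (fun w => vertex_mean (@tail_deg R K (G w))).
Proof.
apply: (measurable_graph_functional hG (X := fun F =>
  vertex_mean (@tail_deg R K F))) => F F'.
  by move=> /vertex_mean_tail_giso ->.
by move=> nF nF'; rewrite !vertex_mean_infinite.
Qed.

Lemma measurable_tail (K e : R) :
  measurable [set w | e < vertex_mean (@tail_deg R K (G w))].
Proof.
have := measurable_vertex_mean_tail K measurableT (measurable_itv `]e, +oo[).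
by rewrite setTI; congr measurable; apply/seteqP; split=> w; rewrite /= in_itv/= andbT.
Qed.

Lemma tail_markov (K e b : R) : 0 < e ->
  (uniform_vertex_expectation P G (tail_deg K) <= (e * b)%:E)%E ->
  (P [set w | (e < vertex_mean (@tail_deg R K (G w)))%R] <= b%:E)%E.
Proof.
move=> e0; set A := [set w | _]; rewrite /uniform_vertex_expectation unlock => h.
have mA : measurable A by exact: measurable_tail.
rewrite -(@lee_pmul2l _ e%:E)// -EFinM; apply: le_trans h.
rewrite -[X in (_ * P X)%E](setIT A) -integral_indic//.
have mI : measurable_fun setT (fun w => (\1_A w : R)%:E).
  by apply/measurable_EFinP; exact: measurable_indic.
rewrite -ge0_integralZl_EFin//; last exact: ltW.
apply: ge0_le_integral => //.
- by move=> w _; rewrite mule_ge0// lee_fin ltW.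
- exact: measurable_funeM.
- by apply/measurable_EFinP; exact: measurable_vertex_mean_tail.
- move=> w _; rewrite -EFinM lee_fin indicE.
  case: (boolP (w \in A)) => [|_]; last by rewrite mulr0 vertex_mean_tail_ge0.
  by rewrite inE mulr1 => /ltW.
Qed.

End TailMarkov.

(** The remainder [eta / 2 ^+ N] of the geometric series is kept, because the union must have
    probability strictly below [eta]. *)
Lemma measure_bigsetU_geometric d (T : measurableType d) (R : realType)
    (P : probability T R) (U : nat -> set T) (eta : R) N :
  (forall i, measurable (U i)) ->
  (forall i, (i < N)%N -> (P (U i) <= (eta / 2 ^+ i.+1)%:E)%E) ->
  (P (\big[setU/set0]_(i < N) U i) <= (eta - eta / 2 ^+ N)%:E)%E.
Proof.
move=> mU; elim: N => [|N IH] hU.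
  by rewrite big_ord0 measure0 expr0 divr1 subrr.
rewrite big_ord_recr/=; apply: le_trans (measureU2 _ _ _) _ => //.
  exact: bigsetU_measurable.
apply: le_trans (leeD (IH _) (hU N _)) _ => //.
  by move=> i iN; apply: hU; rewrite ltnS ltnW.
rewrite -EFinD lee_fin exprS invfM.
have : 0 <= 1 :> R by [].
lra.
Qed.

Lemma cvge0_le (R : realType) (u : nat -> \bar R) :
  (forall n, u n \is a fin_num) -> (forall n, (0 <= u n)%E) ->
  (forall eta : R, 0 < eta -> \forall n \near \oo, (u n <= eta%:E)%E) ->
  u n @[n --> \oo] --> 0%E.
Proof.
move=> uf u0 hu; apply/fine_cvgP; split; first exact: nearW.
apply/cvgrPdist_le => e /hu; apply: filterS => n un /=.
by rewrite sub0r normrN ger0_norm ?fine_ge0// -lee_fin fineK.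
Qed.

Lemma cvge0_near_le (R : realType) (u : nat -> \bar R) (eta : R) : 0 < eta ->
  u n @[n --> \oo] --> 0%E -> \forall n \near \oo, (u n <= eta%:E)%E.
Proof.
move=> eta0 /fine_cvgP[uf /cvgrPdist_le/(_ _ eta0)]; apply: filterS2 uf => n un /=.
rewrite sub0r normrN => h; rewrite -(fineK un) lee_fin.
exact: le_trans (ler_norm _) h.
Qed.

Theorem theorem2p4 (R : realType)
    (d : nat -> measure_display) (Omega : forall n, measurableType (d n))
    (P : forall n, probability (Omega n) R) (G : forall n, Omega n -> graph)
    (d' : measure_display) (Omega' : measurableType d')
    (mu : probability Omega' R) (Go : Omega' -> rooted_graph) (c : R)
    (hG : forall n, random_finite_graph (P n) (G n))
    (hUI : uniformly_integrable_degree P G)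
    (hGo : random_rooted_graph Go)
    (hdeg : (0 < mu [set w | (1 <= root_deg Go w)%N])%E)
    (hcvg : cvg_locally_in_probability P G mu Go) :
  cvg_in_probability P (fun n w => kendall_tau (G n w) c)
    (E_root_nbr mu Go (calH_mu mu Go) / E_root_deg mu Go - 1).
Proof.
move=> eps eps0; set lim := _ - 1.
pose Bad n := [set w | eps < `|kendall_tau (G n w) c - lim|].
have mBad n : measurable (Bad n) by exact: (measurable_kendall_tau (hG n)).
apply: cvge0_le => [n|n|eta eta0]; [exact: fin_num_measure|exact: measure_ge0|].
apply: contrapT => nnear.
have hBad N : ~ forall n, (N <= n)%N -> (P n (Bad n) <= eta%:E)%E.
  by move=> h; apply: nnear; exists N => // n /h.
pose tol i : R := i.+1%:R^-1.
have tol0 i : 0 < tol i by rewrite invr_gt0.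
(* The two exceptional events of index i get probability at most wt i each, so
   that all of them together have probability less than eta. *)
pose wt i : R := eta / 2 ^+ i.+2.
have wt0 i : 0 < wt i by rewrite divr_gt0// exprn_gt0.
(* By Markov's inequality at level [tol i], this choice bounds the probability of [B n i] by [wt i]
   for all [n] at once. *)
have /choice[K hK] : forall i, exists K : R, forall n,
    (uniform_vertex_expectation (P n) (G n) (tail_deg K) <= (tol i * wt i)%:E)%E.
  by move=> i; apply: hUI; rewrite mulr_gt0.
pose p (H : rooted_graph) := fine (mu [set w | riso (ball_graph 2 (Go w)) H]).
pose A j n i := [set w | tol j < `|vertex_mean (fun v : G n w =>
  (`[< riso (ball_graph 2 (Rooted v)) (rooted_type i) >])%:R) - p (rooted_type i)|].
pose B n i := [set w | tol i < vertex_mean (@tail_deg R (K i) (G n w))].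
have mA j n i : measurable (A j n i) by exact: measurable_vertex_mean_ball.
have mB n i : measurable (B n i) by exact: measurable_tail.
have AB_le j i : \forall n \near \oo,
    (P n (A j n i `|` B n i) <= (eta / 2 ^+ i.+1)%:E)%E.
  have := cvge0_near_le (wt0 i) (@hcvg (rooted_type i) 2 _ (tol0 j)).
  apply: filterS => n hA; apply: le_trans (measureU2 _ (mA j n i) (mB n i)) _.
  have hB := tail_markov (hG n) (tol0 i) (hK i n).
  apply: le_trans (leeD hA hB) _.
  rewrite -EFinD lee_fin /wt [in 2 ^+ i.+2]exprS invfM.
  by have : 0 <= 1 :> R by []; lra.
(* Stage [j] asks only for the events of index below [j], so some large [n] handles all of them
   while [Bad n] has probability above [eta]. Convergence along the sample comes from [tol j], and
   [n] may depend on [j] in any way. *)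
have sample j : exists w : {n & Omega n},
    [/\ finite_graph (G _ (projT2 w)), [set: G _ (projT2 w)] !=set0,
      Bad _ (projT2 w) & forall i, (i < j)%N -> ~ (A j _ i `|` B _ i) (projT2 w)].
  have : \forall n \near \oo, forall i : 'I_j,
      (P n (A j n i `|` B n i) <= (eta / 2 ^+ i.+1)%:E)%E.
    by apply: filter_forall => i; exact: AB_le.
  move=> [N _ hN]; have /existsNP[n /not_implyP[Nn Pn]] := hBad N.
  (* [Nul] is a null set containing every sample point whose graph is infinite or empty. *)
  have [_ [Nul [mNul PNul hNul]]] := hG n.
  pose U := \big[setU/set0]_(i < j) (A j n i `|` B n i).
  have mU : measurable U by apply: bigsetU_measurable => i _; exact: measurableU.
  have PU : (P n (Nul `|` U) < eta%:E)%E.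
    apply: le_lt_trans (measureU2 _ mNul mU) _.
    rewrite [X in (X + _)%E]PNul add0e.
    apply: (@le_lt_trans _ _ (eta - eta / 2 ^+ j)%:E).
      rewrite /U; apply: (@measure_bigsetU_geometric _ _ _ (P n)
        (fun i => A j n i `|` B n i)).
      - by move=> i; exact: measurableU.
      - by move=> i ij; exact: (hN n Nn (Ordinal ij)).
    by rewrite lte_fin ltrBlDr ltrDl divr_gt0// exprn_gt0.
  (* [Bad n] has probability above [eta] and the exceptional set less than [eta], so the former is
     not contained in the latter. *)
  have /existsNP[w /not_implyP[Bw NUw]] : ~ (Bad n `<=` Nul `|` U).
    move=> sub; apply: Pn; apply: le_trans (ltW PU).
    by apply: le_measure => //; rewrite inE//; exact: measurableU.
  have [nN nU] : ~ Nul w /\ ~ U w by apply/not_orP.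
  have [fw nw] : finite_graph (G n w) /\ [set: G n w] !=set0.
    by apply: contrapT => /hNul.
  exists (existT _ n w); split => //= i ij ABw; apply: nU.
  by rewrite /U -(bigcup_mkord j (fun i => A j n i `|` B n i)); exists i.
have /choice[f hf] := sample.
pose F j := G _ (projT2 (f j)).
have finF j : finite_graph (F j) by have [] := hf j.
have neF j : [set: F j] !=set0 by have [] := hf j.
have FA j i : (i < j)%N -> ~ A j _ i (projT2 (f j)).
  by move=> ij Aw; have [_ _ _ /(_ i ij)] := hf j; apply; left.
have FB j i : (i < j)%N -> ~ B _ i (projT2 (f j)).
  by move=> ij Bw; have [_ _ _ /(_ i ij)] := hf j; apply; right.
have tol_lt (e : R) : 0 < e -> \forall j \near \oo, tol j < e.
  by move=> e0; exact: (near_infty_natSinv_lt (PosNum e0)).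
have F_cvg i : vertex_mean (fun v : F j =>
    (`[< riso (ball_graph 2 (Rooted v)) (rooted_type i) >])%:R) @[j --> \oo] -->
    p (rooted_type i).
  apply/cvgrPdist_le => e /tol_lt te; near=> j.
  rewrite distrC; apply: (@le_trans _ _ (tol j)); last first.
    by apply: ltW; near: j; exact: te.
  rewrite leNgt; apply/negP; apply: (FA j i).
  by near: j; exact: nbhs_infty_gt.
have F_UI (delta : R) : 0 < delta -> exists K : R,
    \forall j \near \oo, vertex_mean (@tail_deg R K (F j)) <= delta.
  (* One index [i] with [tol i] below [delta] is enough: every sample point with [j] above [i]
     avoids [B _ i]. *)
  move=> /tol_lt te; have [i ti] := filter_ex te; exists (K i); near=> j.
  apply: le_trans (ltW ti).
  rewrite leNgt; apply/negP; apply: (FB j i).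
  by near: j; exact: nbhs_infty_gt.
have /cvgrPdist_lt/(_ _ eps0) := kendall_tau_cvg hGo hdeg finF neF F_cvg F_UI c.
move=> /filter_ex[j]; have [_ _ Bj _] := hf j.
by rewrite distrC => /(lt_trans Bj); rewrite ltxx.
Unshelve. all: by end_near. Qed.
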